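(* Let $M$ be a smooth oriented surface in $E^3$ without umbilic points and without critical points of its mean curvature $H$, with notation as in the context, satisfying $d\alpha_1=0$, $d\alpha_2=\alpha_1\wedge\alpha_2$, and let $(s,t)$ be local coordinates on a connected coordinate rectangle in $M$ in which $\xi_1=e(s)\,ds$, $\xi_2=e(s)\,dt$ with $e(s)>0$ and in which $A,H,J$ are functions of $s$ only. Put $Q=H'/J=Ae>0$ and $E=e^2$. Then there is a constant $\tau$ such that $$E(s)=\tau\,\frac{Q(s)}{J(s)}=\tau\,\frac{Q(s)^2}{H'(s)},$$ and the mean curvature satisfies the third-order differential equation $$\Big(\frac{H''}{H'}\Big)'+2\tau H'=2Q^2\Big(1+\tau\frac{H^2}{H'}\Big).$$ Furthermore, the first and second fundamental forms of $M$ are $$I=E(s)(ds^2+dt^2),\qquad II=L\,ds^2+2M\,ds\,dt+N\,dt^2,$$ with coefficients $L=E(H+J\cos(2\psi))=EH+\tau Q\cos(2\psi)$, $M=-EJ\sin(2\psi)=-\tau Q\sin(2\psi)$, $N=E(H-J\cos(2\psi))$.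
   Context: The surface $M$ carries an orthonormal frame $e_1,e_2,e_3$ with $e_3$ the unit normal and $e_1,e_2$ along principal directions; $\omega_1,\omega_2$ is the coframe dual to $e_1,e_2$, and $\omega_{12}=h\omega_1+k\omega_2$ is the connection form, i.e. $d\omega_1=\omega_{12}\wedge\omega_2$, $d\omega_2=\omega_1\wedge\omega_{12}$. The principal curvatures are $a>c$, so $\omega_{13}=a\omega_1$, $\omega_{23}=c\omega_2$ and $II=a\,\omega_1^2+c\,\omega_2^2$; $H=\frac12(a+c)$, $J=\frac12(a-c)>0$; the Gauss equation is $d\omega_{12}=-ac\,\omega_1\wedge\omega_2$. By the Codazzi equations there are functions $u,v$ with $\frac{1}{a-c}da-h\omega_2=(u-k)\omega_1$ and $\frac1{a-c}dc-k\omega_1=(v-h)\omega_2$; equivalently $dH=J(u\omega_1+v\omega_2)$ and $d\log J=\alpha_1+2*\omega_{12}$, where $*\omega_1=\omega_2$, $*\omega_2=-\omega_1$ and $\alpha_1=u\omega_1-v\omega_2$, $\alpha_2=v\omega_1+u\omega_2$. Set $A=\sqrt{u^2+v^2}>0$ (positive since $dH\neq0$), and let $\psi$ be a local smooth function with $u=A\cos\psi$, $v=A\sin\psi$. Define $\xi_1=\cos\psi\,\omega_1+\sin\psi\,\omega_2$, $\xi_2=-\sin\psi\,\omega_1+\cos\psi\,\omega_2$. Thus $dH=AJ\xi_1$. Primes denote $d/ds$. (The coefficient $M$ in $II$ is not to be confused with the surface $M$.) *)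

(* Defs.v *)
From Stdlib Require Export Reals.
From Coquelicot Require Export Coquelicot.
Open Scope R_scope.

(* A surface is given by a parametrization X of a coordinate rectangle of the
   (s,t)-plane.  Functions on the rectangle are total functions R -> R -> R of
   which only the values on the rectangle matter. *)

Definition in_interval (l r : Rbar) (x : R) : Prop :=
  Rbar_lt l x /\ Rbar_lt x r.

Definition rectangle (s0 s1 t0 t1 : Rbar) (s t : R) : Prop :=
  in_interval s0 s1 s /\ in_interval t0 t1 t.

Definition eq_on {T : Type} (U : R -> R -> Prop) (f g : R -> R -> T) : Prop :=
  forall s t, U s t -> f s t = g s t.

(* C^infinity on an open set U *)
Definition smooth_on (U : R -> R -> Prop) (f : R -> R -> R) : Prop :=
  forall (n : nat) s t, U s t -> ex_diff_n f n s t.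

Definition ds_ (f : R -> R -> R) : R -> R -> R :=
  fun s t => Derive (fun z => f z t) s.
Definition dt_ (f : R -> R -> R) : R -> R -> R :=
  fun s t => Derive (fun z => f s z) t.

Definition vec3 : Type := (R * R * R)%type.
Definition x1 (p : vec3) : R := fst (fst p).
Definition x2 (p : vec3) : R := snd (fst p).
Definition x3 (p : vec3) : R := snd p.

Definition vadd (p q : vec3) : vec3 := (x1 p + x1 q, x2 p + x2 q, x3 p + x3 q).
Definition vscal (r : R) (p : vec3) : vec3 := (r * x1 p, r * x2 p, r * x3 p).
Definition dot (p q : vec3) : R := x1 p * x1 q + x2 p * x2 q + x3 p * x3 q.

Definition vsmooth_on (U : R -> R -> Prop) (V : R -> R -> vec3) : Prop :=
  smooth_on U (fun s t => x1 (V s t)) /\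
  smooth_on U (fun s t => x2 (V s t)) /\
  smooth_on U (fun s t => x3 (V s t)).

Definition vds (V : R -> R -> vec3) : R -> R -> vec3 := fun s t =>
  (ds_ (fun s t => x1 (V s t)) s t,
   ds_ (fun s t => x2 (V s t)) s t,
   ds_ (fun s t => x3 (V s t)) s t).
Definition vdt (V : R -> R -> vec3) : R -> R -> vec3 := fun s t =>
  (dt_ (fun s t => x1 (V s t)) s t,
   dt_ (fun s t => x2 (V s t)) s t,
   dt_ (fun s t => x3 (V s t)) s t).

(* dV(x d/ds + y d/dt) at the point (s,t) *)
Definition vdiff (V : R -> R -> vec3) (s t x y : R) : vec3 :=
  vadd (vscal x (vds V s t)) (vscal y (vdt V s t)).

(* The 1-form p ds + q dt is encoded by its pair of coefficients (p, q), the
   2-form f ds /\ dt by its coefficient f. *)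
Definition form1 : Type := R -> R -> R * R.
Definition form2 : Type := R -> R -> R.

Definition fadd (w z : form1) : form1 := fun s t =>
  (fst (w s t) + fst (z s t), snd (w s t) + snd (z s t)).
Definition fsub (w z : form1) : form1 := fun s t =>
  (fst (w s t) - fst (z s t), snd (w s t) - snd (z s t)).
Definition fscal (f : R -> R -> R) (w : form1) : form1 := fun s t =>
  (f s t * fst (w s t), f s t * snd (w s t)).
Definition wedge (w z : form1) : form2 := fun s t =>
  fst (w s t) * snd (z s t) - snd (w s t) * fst (z s t).

Definition ext_d0 (f : R -> R -> R) : form1 := fun s t => (ds_ f s t, dt_ f s t).
Definition ext_d1 (w : form1) : form2 := fun s t =>
  ds_ (fun s t => snd (w s t)) s t - dt_ (fun s t => fst (w s t)) s t.

Declare Scope form_scope.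
Delimit Scope form_scope with form.
Bind Scope form_scope with form1.
Infix "+" := fadd : form_scope.
Infix "-" := fsub : form_scope.
Notation "f *: w" := (fscal f w) (at level 40, left associativity) : form_scope.

(* the 1-form <dV, W> *)
Definition dform (V W : R -> R -> vec3) : form1 := fun s t =>
  (dot (vds V s t) (W s t), dot (vdt V s t) (W s t)).

Record surface_patch (U : R -> R -> Prop) (X : R -> R -> vec3) : Prop := {
  patch_smooth : vsmooth_on U X;
  patch_regular : forall s t, U s t ->
    forall x y, vdiff X s t x y = (0, 0, 0) -> x = 0 /\ y = 0
}.

Definition first_form (X : R -> R -> vec3) (s t x y : R) : R :=
  dot (vdiff X s t x y) (vdiff X s t x y).
Definition second_form (X e3 : R -> R -> vec3) (s t x y : R) : R :=
  - dot (vdiff X s t x y) (vdiff e3 s t x y).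

(* With e1, e2 tangent and orthonormal, <dX, e1> and <dX, e2> are the coframe
   dual to e1, e2. *)
Definition omega1 (X e1 : R -> R -> vec3) : form1 := dform X e1.
Definition omega2 (X e2 : R -> R -> vec3) : form1 := dform X e2.

(* Smooth orthonormal frame along X with e3 normal to the surface, e1 and e2
   principal with principal curvatures a and c; a > c says that there is no
   umbilic point.  The orientation of the surface is the choice of e3. *)
Record principal_frame (U : R -> R -> Prop) (X e1 e2 e3 : R -> R -> vec3)
    (a c : R -> R -> R) : Prop := {
  frame_smooth1 : vsmooth_on U e1;
  frame_smooth2 : vsmooth_on U e2;
  frame_smooth3 : vsmooth_on U e3;
  frame_unit1 : forall s t, U s t -> dot (e1 s t) (e1 s t) = 1;
  frame_unit2 : forall s t, U s t -> dot (e2 s t) (e2 s t) = 1;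
  frame_unit3 : forall s t, U s t -> dot (e3 s t) (e3 s t) = 1;
  frame_orth12 : forall s t, U s t -> dot (e1 s t) (e2 s t) = 0;
  frame_orth13 : forall s t, U s t -> dot (e1 s t) (e3 s t) = 0;
  frame_orth23 : forall s t, U s t -> dot (e2 s t) (e3 s t) = 0;
  frame_normal : forall s t, U s t -> forall x y,
    dot (vdiff X s t x y) (e3 s t) = 0;
  frame_omega13 : eq_on U (dform e1 e3) (a *: omega1 X e1)%form;
  frame_omega23 : eq_on U (dform e2 e3) (c *: omega2 X e2)%form;
  frame_no_umbilic : forall s t, U s t -> c s t < a s t
}.

(* Structure equations characterizing the connection form w12 of a coframe *)
Definition connection_form (U : R -> R -> Prop) (w1 w2 w12 : form1) : Prop :=
  eq_on U (ext_d1 w1) (wedge w12 w2) /\ eq_on U (ext_d1 w2) (wedge w1 w12).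

(* Equations defining u and v (whose existence is the Codazzi equations) *)
Definition codazzi_functions (U : R -> R -> Prop) (w1 w2 : form1)
    (a c h k u v : R -> R -> R) : Prop :=
  eq_on U ((fun s t => / (a s t - c s t))%R *: ext_d0 a - h *: w2)%form
          ((fun s t => u s t - k s t)%R *: w1)%form /\
  eq_on U ((fun s t => / (a s t - c s t))%R *: ext_d0 c - k *: w1)%form
          ((fun s t => v s t - h s t)%R *: w2)%form.

Definition mean_curvature (a c : R -> R -> R) : R -> R -> R :=
  fun s t => / 2 * (a s t + c s t).
Definition skew_curvature (a c : R -> R -> R) : R -> R -> R :=
  fun s t => / 2 * (a s t - c s t).

Definition alpha1 (w1 w2 : form1) (u v : R -> R -> R) : form1 :=
  (u *: w1 - v *: w2)%form.
Definition alpha2 (w1 w2 : form1) (u v : R -> R -> R) : form1 :=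
  (v *: w1 + u *: w2)%form.

Definition xi1 (w1 w2 : form1) (psi : R -> R -> R) : form1 :=
  ((fun s t => cos (psi s t)) *: w1 + (fun s t => sin (psi s t)) *: w2)%form.
Definition xi2 (w1 w2 : form1) (psi : R -> R -> R) : form1 :=
  ((fun s t => - sin (psi s t)) *: w1 + (fun s t => cos (psi s t)) *: w2)%form.

(* Main.v *)
Require Import Defs.
From Stdlib Require Import Reals Lra.
From Coquelicot Require Import Coquelicot.
Open Scope R_scope.

(* In the coordinates (s,t) the connection form is omega12 = - dpsi + (e'/e) dt, and the
   Codazzi equations become psi_s = - Q sin(2 psi) / 2, psi_t = (P - Q cos(2 psi)) / 2 with
   P = (log (J E))'.  Since alpha1 = Q (cos(2 psi) ds - sin(2 psi) dt) and
   alpha2 = Q (sin(2 psi) ds + cos(2 psi) dt), their structure equations reduce to Q' = Q P,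
   hence J E / Q is a constant tau.  The integrability condition psi_st = psi_ts gives
   P' = Q^2 and the Gauss equation gives (e'/e)' = - (H^2 - J^2) E; as H' = J Q, one has
   H''/H' = 2 P - 2 e'/e, and differentiating once more yields the equation for H. *)

(** * Smooth functions on an open set of the plane *)

(** Functions are total and their values off [U] are arbitrary. Openness is what makes a derivative
    at a point of [U] depend only on values on [U], so equations valid on [U] may be
    differentiated. *)
Definition open_2d (U : R -> R -> Prop) : Prop :=
  forall s t, U s t -> locally_2d U s t.

(** Existence and value of both partial derivatives in one relation: the rules below compose without
    separate differentiability conditions. *)
Definition partials (f : R -> R -> R) (s t p q : R) : Prop :=
  is_derive (fun z => f z t) s p /\ is_derive (fun z => f s z) t q.

Lemma partials_unique f s t p q :
  partials f s t p q -> ds_ f s t = p /\ dt_ f s t = q.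
Proof. intros [Hp Hq]; split; now apply is_derive_unique. Qed.

Lemma partials_eq f s t p q p' q' :
  partials f s t p q -> p = p' -> q = q' -> partials f s t p' q'.
Proof. now intros Hf <- <-. Qed.

Lemma eq_on_partials U f g s t p q :
  open_2d U -> eq_on U f g -> U s t -> partials f s t p q -> partials g s t p q.
Proof.
intros HU Hfg Hst [Hp Hq]; destruct (HU s t Hst) as [d Hd].
split; [apply (is_derive_ext_loc (fun z => f z t)) | apply (is_derive_ext_loc (fun z => f s z))];
  trivial; exists d; intros y Hy; apply Hfg, Hd; trivial;
  rewrite Rminus_diag, Rabs_R0; apply cond_pos.
Qed.

Lemma eq_on_ds U f g s t : open_2d U -> eq_on U f g -> U s t -> ds_ f s t = ds_ g s t.
Proof.
intros HU Hfg Hst; destruct (HU s t Hst) as [d Hd].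
apply Derive_ext_loc; exists d; intros y Hy; apply Hfg, Hd; trivial.
rewrite Rminus_diag, Rabs_R0; apply cond_pos.
Qed.

Lemma eq_on_dt U f g s t : open_2d U -> eq_on U f g -> U s t -> dt_ f s t = dt_ g s t.
Proof.
intros HU Hfg Hst; destruct (HU s t Hst) as [d Hd].
apply Derive_ext_loc; exists d; intros y Hy; apply Hfg, Hd; trivial.
rewrite Rminus_diag, Rabs_R0; apply cond_pos.
Qed.

Lemma partials_const c s t : partials (fun _ _ => c) s t 0 0.
Proof. split; apply (is_derive_const c). Qed.

Lemma partials_plus f g s t p q p' q' :
  partials f s t p q -> partials g s t p' q' ->
  partials (fun s t => f s t + g s t) s t (p + p') (q + q').
Proof.
intros [Hp Hq] [Hp' Hq']; split.
- now apply (is_derive_plus (fun z => f z t) (fun z => g z t)).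
- now apply (is_derive_plus (fun z => f s z) (fun z => g s z)).
Qed.

Lemma partials_opp f s t p q :
  partials f s t p q -> partials (fun s t => - f s t) s t (- p) (- q).
Proof.
intros [Hp Hq]; split.
- now apply (is_derive_opp (fun z => f z t)).
- now apply (is_derive_opp (fun z => f s z)).
Qed.

Lemma partials_mult f g s t p q p' q' :
  partials f s t p q -> partials g s t p' q' ->
  partials (fun s t => f s t * g s t) s t
    (p * g s t + f s t * p') (q * g s t + f s t * q').
Proof.
intros [Hp Hq] [Hp' Hq']; split.
- apply (is_derive_mult (fun z => f z t) (fun z => g z t)); trivial; intros; apply Rmult_comm.
- apply (is_derive_mult (fun z => f s z) (fun z => g s z)); trivial; intros; apply Rmult_comm.
Qed.

Lemma partials_comp F l f s t p q :
  is_derive F (f s t) l -> partials f s t p q ->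
  partials (fun s t => F (f s t)) s t (p * l) (q * l).
Proof.
intros HF [Hp Hq]; split.
- now apply (is_derive_comp F (fun z => f z t)).
- now apply (is_derive_comp F (fun z => f s z)).
Qed.

Lemma is_derive_Rinv x : x <> 0 -> is_derive Rinv x (- / (x * x)).
Proof. intros Hx; auto_derive; trivial; now field. Qed.

Lemma partials_smooth U f s t :
  smooth_on U f -> U s t -> partials f s t (ds_ f s t) (dt_ f s t).
Proof.
intros Hf Hst; destruct (Hf 1%nat s t Hst) as (_ & H1 & H2 & _).
split; now apply Derive_correct.
Qed.

Lemma smooth_ds U f : smooth_on U f -> smooth_on U (ds_ f).
Proof. intros Hf n s t Hst; exact (ex_diff_n_deriv_aux1 f n s t (Hf (S n) s t Hst)). Qed.

Lemma smooth_dt U f : smooth_on U f -> smooth_on U (dt_ f).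
Proof. intros Hf n s t Hst; exact (ex_diff_n_deriv_aux2 f n s t (Hf (S n) s t Hst)). Qed.

Lemma smooth_continuity U f s t : smooth_on U f -> U s t -> continuity_2d_pt f s t.
Proof. intros Hf Hst; exact (proj1 (Hf 0%nat s t Hst)). Qed.

Lemma locally_2d_eq_on U (f g : R -> R -> R) s t :
  open_2d U -> eq_on U f g -> U s t -> locally_2d (fun s t => f s t = g s t) s t.
Proof.
intros HU Hfg Hst; destruct (HU s t Hst) as [d Hd].
exists d; intros; now apply Hfg, Hd.
Qed.

Lemma eq_on_smooth U f g : open_2d U -> eq_on U f g -> smooth_on U f -> smooth_on U g.
Proof.
intros HU Hfg Hf n s t Hst.
apply (ex_diff_n_ext_loc f); [now apply (locally_2d_eq_on U) | now apply Hf].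
Qed.

Lemma smooth_schwarz U f s t :
  open_2d U -> smooth_on U f -> U s t -> ds_ (dt_ f) s t = dt_ (ds_ f) s t.
Proof.
intros HU Hf Hst; apply Schwarz.
(* Schwarz's theorem wants first and mixed derivatives in a whole neighbourhood, and continuity of
   the mixed ones at the point only. *)
- destruct (HU s t Hst) as [d Hd]; exists d; intros x y Hx Hy.
  specialize (Hd x y Hx Hy).
  destruct (Hf 1%nat _ _ Hd) as (_ & H1 & H2 & _).
  destruct (smooth_ds _ _ Hf 1%nat _ _ Hd) as (_ & _ & H3 & _).
  destruct (smooth_dt _ _ Hf 1%nat _ _ Hd) as (_ & H4 & _).
  now repeat split.
- exact (smooth_continuity _ _ _ _ (smooth_ds _ _ (smooth_dt _ _ Hf)) Hst).
- exact (smooth_continuity _ _ _ _ (smooth_dt _ _ (smooth_ds _ _ Hf)) Hst).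
Qed.

(* The partial derivatives of an expression are again expressions, so that all
   closure properties of [smooth_on] follow from one induction on the order. *)
Inductive smooth_expr (U : R -> R -> Prop) : (R -> R -> R) -> Prop :=
| expr_smooth f : smooth_on U f -> smooth_expr U f
| expr_const c : smooth_expr U (fun _ _ => c)
| expr_plus f g : smooth_expr U f -> smooth_expr U g ->
    smooth_expr U (fun s t => f s t + g s t)
| expr_opp f : smooth_expr U f -> smooth_expr U (fun s t => - f s t)
| expr_mult f g : smooth_expr U f -> smooth_expr U g ->
    smooth_expr U (fun s t => f s t * g s t)
| expr_inv f : (forall s t, U s t -> f s t <> 0) -> smooth_expr U f ->
    smooth_expr U (fun s t => / f s t)
| expr_sin f : smooth_expr U f -> smooth_expr U (fun s t => sin (f s t))
| expr_cos f : smooth_expr U f -> smooth_expr U (fun s t => cos (f s t)).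

Lemma smooth_expr_continuity U f s t :
  smooth_expr U f -> U s t -> continuity_2d_pt f s t.
Proof.
intros Hf Hst; induction Hf.
- now apply (smooth_continuity U).
- apply continuity_2d_pt_const.
- now apply continuity_2d_pt_plus.
- now apply continuity_2d_pt_opp.
- now apply continuity_2d_pt_mult.
- apply continuity_2d_pt_inv; auto.
- apply continuity_1d_2d_pt_comp; trivial; apply continuity_sin.
- apply continuity_1d_2d_pt_comp; trivial; apply continuity_cos.
Qed.

Ltac smooth_expr_auto :=
  auto 6 using expr_const, expr_plus, expr_opp, expr_mult, expr_sin, expr_cos.

Lemma smooth_expr_partials U f : smooth_expr U f ->
  exists g1 g2, smooth_expr U g1 /\ smooth_expr U g2 /\
    forall s t, U s t -> partials f s t (g1 s t) (g2 s t).
Proof.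
intros Hf; induction Hf as [f Hf|c|f g Hf (f1 & f2 & Hf1 & Hf2 & Df) Hg (g1 & g2 & Hg1 & Hg2 & Dg)
  |f Hf (f1 & f2 & Hf1 & Hf2 & Df)
  |f g Hf (f1 & f2 & Hf1 & Hf2 & Df) Hg (g1 & g2 & Hg1 & Hg2 & Dg)
  |f H0 Hf (f1 & f2 & Hf1 & Hf2 & Df)|f Hf (f1 & f2 & Hf1 & Hf2 & Df)
  |f Hf (f1 & f2 & Hf1 & Hf2 & Df)].
- exists (ds_ f), (dt_ f); split; [now apply expr_smooth, smooth_ds | ].
  split; [now apply expr_smooth, smooth_dt | ].
  intros s t Hst; now apply (partials_smooth U).
- do 2 eexists; split; [ | split; [ | intros s t _; apply partials_const]];
    smooth_expr_auto.
- do 2 eexists; split; [ | split; [ | intros s t Hst; apply partials_plus; auto]];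
    smooth_expr_auto.
- do 2 eexists; split; [ | split; [ | intros s t Hst; apply partials_opp; auto]];
    smooth_expr_auto.
- do 2 eexists; split; [ | split; [ | intros s t Hst; apply partials_mult; auto]];
    smooth_expr_auto.
(* The derivative of an inverse is again an expression, since the new denominator [f * f] does not
   vanish on [U] either. *)
- assert (H2 : smooth_expr U (fun s t => - / (f s t * f s t))).
  { apply expr_opp, expr_inv; [ | now apply expr_mult].
    intros s t Hst; specialize (H0 s t Hst); now apply Rmult_integral_contrapositive. }
  exists (fun s t => f1 s t * - / (f s t * f s t)), (fun s t => f2 s t * - / (f s t * f s t)).
  split; [now apply expr_mult | split; [now apply expr_mult | ]].
  intros s t Hst; apply (partials_comp Rinv); auto; now apply is_derive_Rinv, H0.
- do 2 eexists; split; [ | split; [ | intros s t Hst; apply (partials_comp sin);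
    [apply is_derive_sin | auto]]]; smooth_expr_auto.
- do 2 eexists; split; [ | split; [ | intros s t Hst; apply (partials_comp cos);
    [apply is_derive_cos | auto]]]; smooth_expr_auto.
Qed.

Lemma smooth_expr_smooth U f : open_2d U -> smooth_expr U f -> smooth_on U f.
Proof.
(* [f] is generalized because the induction hypothesis is applied to its partial derivatives [g1]
   and [g2]. *)
intros HU Hf n; revert f Hf; induction n as [|n IH]; intros f Hf s t Hst.
- split; trivial; now apply (smooth_expr_continuity U).
- destruct (smooth_expr_partials U f Hf) as (g1 & g2 & Hg1 & Hg2 & Df).
  split; [now apply (smooth_expr_continuity U) | ].
  split; [exists (g1 s t); apply Df, Hst | ].
  split; [exists (g2 s t); apply Df, Hst | ].
  split; [apply (ex_diff_n_ext_loc g1) | apply (ex_diff_n_ext_loc g2)]; auto;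
    apply (locally_2d_eq_on U); trivial; intros x y Hxy; symmetry;
    apply is_derive_unique, Df, Hxy.
Qed.

(** * The structure equations of a frame *)

Lemma dot_comm v w : dot v w = dot w v.
Proof. unfold dot; ring. Qed.

Lemma dot_vadd_l v w x : dot (vadd v w) x = dot v x + dot w x.
Proof. unfold dot, vadd, x1, x2, x3; simpl; ring. Qed.

Lemma dot_vscal_l r v x : dot (vscal r v) x = r * dot v x.
Proof. unfold dot, vscal, x1, x2, x3; simpl; ring. Qed.

Definition cross (v w : vec3) : vec3 :=
  (x2 v * x3 w - x3 v * x2 w, x3 v * x1 w - x1 v * x3 w, x1 v * x2 w - x2 v * x1 w).

Lemma dot_cross_cross v w x y :
  dot (cross v w) (cross x y) = dot v x * dot w y - dot v y * dot w x.
Proof. unfold dot, cross, x1, x2, x3; simpl; ring. Qed.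

(* Cramer's rule expresses D v and D w, where D is the determinant of the frame,
   through the cross products, which are orthonormal; moreover D^2 = 1. *)
Lemma dot_orthonormal_frame f1 f2 f3 v w :
  dot f1 f1 = 1 -> dot f2 f2 = 1 -> dot f3 f3 = 1 ->
  dot f1 f2 = 0 -> dot f1 f3 = 0 -> dot f2 f3 = 0 ->
  dot v w = dot v f1 * dot w f1 + dot v f2 * dot w f2 + dot v f3 * dot w f3.
Proof.
intros H11 H22 H33 H12 H13 H23.
set (D := dot f1 (cross f2 f3)).
assert (HD : D * D = 1).
{ transitivity (dot f1 f1 * dot f2 f2 * dot f3 f3 + 2 * dot f1 f2 * dot f1 f3 * dot f2 f3
    - dot f1 f1 * dot f2 f3 * dot f2 f3 - dot f2 f2 * dot f1 f3 * dot f1 f3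
    - dot f3 f3 * dot f1 f2 * dot f1 f2).
  - unfold D, dot, cross, x1, x2, x3; simpl; ring.
  - rewrite H11, H22, H33, H12, H13, H23; ring. }
assert (Cramer : forall x, vscal D x =
  vadd (vadd (vscal (dot x f1) (cross f2 f3)) (vscal (dot x f2) (cross f3 f1)))
    (vscal (dot x f3) (cross f1 f2))).
{ intros x; unfold D, vscal, vadd, dot, cross, x1, x2, x3; simpl.
  f_equal; [f_equal | ]; ring. }
transitivity (dot (vscal D v) (vscal D w)).
- rewrite dot_vscal_l, (dot_comm v (vscal _ _)), dot_vscal_l, <- Rmult_assoc, HD, (dot_comm w); ring.
- rewrite !Cramer, !dot_vadd_l, !dot_vscal_l.
  do 3 rewrite (dot_comm (cross _ _) (vadd _ _)), !dot_vadd_l, !dot_vscal_l.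
  rewrite !dot_cross_cross, ?(dot_comm f2 f1), ?(dot_comm f3 f1), ?(dot_comm f3 f2).
  rewrite H11, H22, H33, H12, H13, H23; ring.
Qed.

Lemma vsmooth_vds U V : vsmooth_on U V -> vsmooth_on U (vds V).
Proof.
intros (H1 & H2 & H3); split; [exact (smooth_ds _ _ H1) | split];
  [exact (smooth_ds _ _ H2) | exact (smooth_ds _ _ H3)].
Qed.

Lemma vsmooth_vdt U V : vsmooth_on U V -> vsmooth_on U (vdt V).
Proof.
intros (H1 & H2 & H3); split; [exact (smooth_dt _ _ H1) | split];
  [exact (smooth_dt _ _ H2) | exact (smooth_dt _ _ H3)].
Qed.

Lemma vsmooth_schwarz U V s t :
  open_2d U -> vsmooth_on U V -> U s t -> vds (vdt V) s t = vdt (vds V) s t.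
Proof.
intros HU (H1 & H2 & H3) Hst; unfold vds, vdt.
f_equal; [f_equal | ]; now apply (smooth_schwarz U).
Qed.

Lemma smooth_dot U V W :
  open_2d U -> vsmooth_on U V -> vsmooth_on U W -> smooth_on U (fun s t => dot (V s t) (W s t)).
Proof.
intros HU (V1 & V2 & V3) (W1 & W2 & W3); apply smooth_expr_smooth; trivial; unfold dot.
apply expr_plus; [apply expr_plus | ]; apply expr_mult; now apply expr_smooth.
Qed.

Lemma partials_dot U V W s t :
  vsmooth_on U V -> vsmooth_on U W -> U s t ->
  partials (fun s t => dot (V s t) (W s t)) s t
    (dot (vds V s t) (W s t) + dot (V s t) (vds W s t))
    (dot (vdt V s t) (W s t) + dot (V s t) (vdt W s t)).
Proof.
intros (V1 & V2 & V3) (W1 & W2 & W3) Hst; unfold dot.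
eapply partials_eq.
- apply partials_plus; [apply partials_plus | ]; apply partials_mult;
    now apply (partials_smooth U).
- unfold vds, x1, x2, x3; simpl; ring.
- unfold vdt, x1, x2, x3; simpl; ring.
Qed.

(** Leibniz rule for a constant inner product. Applied to the frame vectors, it yields the
    skew-symmetry of the matrix of forms [<de_i, e_j>]. *)
Lemma dot_constant_partials U V W r s t :
  open_2d U -> vsmooth_on U V -> vsmooth_on U W ->
  (forall s t, U s t -> dot (V s t) (W s t) = r) -> U s t ->
  dot (vds W s t) (V s t) = - dot (vds V s t) (W s t) /\
  dot (vdt W s t) (V s t) = - dot (vdt V s t) (W s t).
Proof.
intros HU HV HW Hr Hst.
assert (H := eq_on_partials _ _ (fun _ _ => r) _ _ _ _ HU Hr Hst
  (partials_dot _ _ _ _ _ HV HW Hst)).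
destruct (partials_unique _ _ _ _ _ H) as [H1 H2].
destruct (partials_unique _ _ _ _ _ (partials_const r s t)) as [H3 H4].
rewrite H3 in H1; rewrite H4 in H2.
rewrite (dot_comm (vds W s t)), (dot_comm (vdt W s t)); lra.
Qed.

(** The second derivatives of [V] cancel by symmetry, which leaves only products of first
    derivatives. *)
Lemma ext_d1_dform U V W s t :
  open_2d U -> vsmooth_on U V -> vsmooth_on U W -> U s t ->
  ext_d1 (dform V W) s t =
    dot (vdt V s t) (vds W s t) - dot (vds V s t) (vdt W s t).
Proof.
intros HU HV HW Hst; unfold ext_d1, dform; simpl.
destruct (partials_unique _ _ _ _ _
  (partials_dot U (vdt V) W s t (vsmooth_vdt _ _ HV) HW Hst)) as [-> _].
destruct (partials_unique _ _ _ _ _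
  (partials_dot U (vds V) W s t (vsmooth_vds _ _ HV) HW Hst)) as [_ ->].
rewrite (vsmooth_schwarz U) by trivial; ring.
Qed.

(** The linear algebra of the frame at one point: tangency of [dX], expansion in the orthonormal
    basis, and skew-symmetry of the connection matrix in both coordinate directions. *)
Record adapted_frame (U : R -> R -> Prop) (X e1 e2 e3 : R -> R -> vec3) (s t : R) : Prop := {
  adapted_X3s : dot (vds X s t) (e3 s t) = 0;
  adapted_X3t : dot (vdt X s t) (e3 s t) = 0;
  adapted_dot : forall v w, dot v w = dot v (e1 s t) * dot w (e1 s t)
    + dot v (e2 s t) * dot w (e2 s t) + dot v (e3 s t) * dot w (e3 s t);
  adapted_11s : dot (vds e1 s t) (e1 s t) = 0;
  adapted_11t : dot (vdt e1 s t) (e1 s t) = 0;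
  adapted_22s : dot (vds e2 s t) (e2 s t) = 0;
  adapted_22t : dot (vdt e2 s t) (e2 s t) = 0;
  adapted_21s : dot (vds e2 s t) (e1 s t) = - dot (vds e1 s t) (e2 s t);
  adapted_21t : dot (vdt e2 s t) (e1 s t) = - dot (vdt e1 s t) (e2 s t);
  adapted_31s : dot (vds e3 s t) (e1 s t) = - dot (vds e1 s t) (e3 s t);
  adapted_31t : dot (vdt e3 s t) (e1 s t) = - dot (vdt e1 s t) (e3 s t);
  adapted_32s : dot (vds e3 s t) (e2 s t) = - dot (vds e2 s t) (e3 s t);
  adapted_32t : dot (vdt e3 s t) (e2 s t) = - dot (vdt e2 s t) (e3 s t)
}.

Lemma principal_frame_adapted U X e1 e2 e3 a c s t :
  open_2d U -> principal_frame U X e1 e2 e3 a c -> U s t ->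
  adapted_frame U X e1 e2 e3 s t.
Proof.
intros HU [S1 S2 S3 U1 U2 U3 O12 O13 O23 N _ _ _] Hst.
destruct (dot_constant_partials _ _ _ _ _ _ HU S1 S1 U1 Hst).
destruct (dot_constant_partials _ _ _ _ _ _ HU S2 S2 U2 Hst).
destruct (dot_constant_partials _ _ _ _ _ _ HU S1 S2 O12 Hst).
destruct (dot_constant_partials _ _ _ _ _ _ HU S1 S3 O13 Hst).
destruct (dot_constant_partials _ _ _ _ _ _ HU S2 S3 O23 Hst).
(* Normality of [e3], given for all directions, is read off along the two coordinate directions. *)
assert (Ns := N s t Hst 1 0); assert (Nt := N s t Hst 0 1).
unfold vdiff in Ns, Nt; rewrite dot_vadd_l, !dot_vscal_l in Ns, Nt.
split; trivial; try lra.
intros; apply dot_orthonormal_frame; auto.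
Qed.

(** The form [h *: w1 + k *: w2] is known only through these structure equations. Since [<de1, e2>]
    satisfies them too, both forms get the same coefficients in [isothermal_connection], and the
    Gauss equation becomes available. *)
Lemma frame_structure_equations U X e1 e2 e3 a c s t :
  open_2d U -> surface_patch U X -> principal_frame U X e1 e2 e3 a c -> U s t ->
  ext_d1 (omega1 X e1) s t = wedge (dform e1 e2) (omega2 X e2) s t /\
  ext_d1 (omega2 X e2) s t = wedge (omega1 X e1) (dform e1 e2) s t.
Proof.
intros HU [HX _] HF Hst.
destruct (principal_frame_adapted _ _ _ _ _ _ _ _ _ HU HF Hst)
  as [Xs Xt Hdot E1 E2 E3 E4 E5 E6 E7 E8 E9 E10].
unfold omega1, omega2; rewrite !(ext_d1_dform U); trivial;
  try now destruct HF.
unfold wedge, dform; simpl.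
rewrite (Hdot (vdt X s t)), (Hdot (vds X s t)), Xs, Xt, E1, E2.
rewrite (Hdot (vdt X s t) (vds e2 s t)), (Hdot (vds X s t) (vdt e2 s t)), Xs, Xt, E3, E4, E5, E6.
split; ring.
Qed.

(** Expanding [<de1, de2>] in the frame, the [e1] and [e2] terms vanish because [<de1, e1>] and
    [<de2, e2>] do. What remains is minus the wedge of [<de1, e3>] and [<de2, e3>], that is of
    [a w1] and [c w2]. *)
Lemma frame_gauss_equation U X e1 e2 e3 a c s t :
  open_2d U -> surface_patch U X -> principal_frame U X e1 e2 e3 a c -> U s t ->
  ext_d1 (dform e1 e2) s t =
    - (a s t * c s t * wedge (omega1 X e1) (omega2 X e2) s t).
Proof.
intros HU [HX _] HF Hst.
destruct (principal_frame_adapted _ _ _ _ _ _ _ _ _ HU HF Hst)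
  as [Xs Xt Hdot E1 E2 E3 E4 _ _ _ _ _ _].
destruct HF as [S1 S2 S3 _ _ _ _ _ _ _ W13 W23 _].
rewrite (ext_d1_dform U); trivial.
rewrite (Hdot (vdt e1 s t)), (Hdot (vds e1 s t)), E1, E2, E3, E4.
injection (W13 s t Hst) as -> ->; injection (W23 s t Hst) as -> ->.
unfold wedge, omega1, omega2, dform; simpl; ring.
Qed.

Definition eval1 (w : Defs.form1) (s t x y : R) : R := x * fst (w s t) + y * snd (w s t).

(** Both follow by expanding in the frame. The minus sign of [second_form] is absorbed by the
    skew-symmetry [<de3, e_i> = - <de_i, e3>]. *)
Lemma frame_fundamental_forms U X e1 e2 e3 a c s t x y :
  open_2d U -> principal_frame U X e1 e2 e3 a c -> U s t ->
  first_form X s t x y = eval1 (omega1 X e1) s t x y ^ 2 + eval1 (omega2 X e2) s t x y ^ 2 /\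
  second_form X e3 s t x y = a s t * eval1 (omega1 X e1) s t x y ^ 2
    + c s t * eval1 (omega2 X e2) s t x y ^ 2.
Proof.
intros HU HF Hst.
destruct (principal_frame_adapted _ _ _ _ _ _ _ _ _ HU HF Hst)
  as [Xs Xt Hdot _ _ _ _ _ _ E7 E8 E9 E10].
destruct HF as [_ _ _ _ _ _ _ _ _ _ W13 W23 _].
injection (W13 s t Hst) as E11 E12; injection (W23 s t Hst) as E13 E14.
unfold first_form, second_form, eval1, omega1, omega2, dform, vdiff in *; simpl in *.
rewrite (Hdot (vadd _ _)), (Hdot (vadd _ _) (vadd _ (vscal y (vdt e3 s t)))).
rewrite !dot_vadd_l, !dot_vscal_l, Xs, Xt, E7, E8, E9, E10, E11, E12, E13, E14.
split; ring.
Qed.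

(** * Isothermal coframes *)

Lemma in_interval_inhabited l r : Rbar_lt l r -> exists x, in_interval l r x.
Proof.
unfold in_interval; destruct l as [l| |], r as [r| |]; simpl; try easy; intros H.
- exists ((l + r) / 2); lra.
- exists (l + 1); lra.
- exists (r - 1); lra.
- now exists 0.
Qed.

Lemma in_interval_convex l r x y z :
  in_interval l r x -> in_interval l r y -> x <= z <= y -> in_interval l r z.
Proof.
intros [Hx _] [_ Hy] Hz; split.
- now apply (Rbar_lt_le_trans _ x).
- now apply (Rbar_le_lt_trans _ y).
Qed.

Lemma in_interval_open l r x :
  in_interval l r x -> exists d : posreal, forall y, Rabs (y - x) < d -> in_interval l r y.
Proof.
intros [Hl Hr].
assert (El : exists d : posreal, forall y, Rabs (y - x) < d -> Rbar_lt l y).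
{ destruct l as [l| |]; simpl in *; try easy; [ | now exists (mkposreal 1 Rlt_0_1)].
  assert (Hd : 0 < x - l) by lra; exists (mkposreal _ Hd); simpl.
  intros y Hy; apply Rabs_def2 in Hy; lra. }
assert (Er : exists d : posreal, forall y, Rabs (y - x) < d -> Rbar_lt y r).
{ destruct r as [r| |]; simpl in *; try easy; [ | now exists (mkposreal 1 Rlt_0_1)].
  assert (Hd : 0 < r - x) by lra; exists (mkposreal _ Hd); simpl.
  intros y Hy; apply Rabs_def2 in Hy; lra. }
destruct El as [d1 H1], Er as [d2 H2].
exists (mkposreal _ (Rmin_stable_in_posreal d1 d2)); simpl; intros y Hy; split.
- apply H1; now apply (Rlt_le_trans _ _ _ Hy), Rmin_l.
- apply H2; now apply (Rlt_le_trans _ _ _ Hy), Rmin_r.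
Qed.

Lemma rectangle_open s0 s1 t0 t1 : open_2d (rectangle s0 s1 t0 t1).
Proof.
intros s t [Hs Ht].
destruct (in_interval_open _ _ _ Hs) as [d1 H1], (in_interval_open _ _ _ Ht) as [d2 H2].
exists (mkposreal _ (Rmin_stable_in_posreal d1 d2)); simpl; intros x y Hx Hy; split.
- apply H1; now apply (Rlt_le_trans _ _ _ Hx), Rmin_l.
- apply H2; now apply (Rlt_le_trans _ _ _ Hy), Rmin_r.
Qed.

(** Functions of [s] alone enter as functions on the rectangle that are constant in [t], so the
    calculus of the plane covers them. *)
Lemma partials_1d U (F : R -> R) s t :
  smooth_on U (fun s _ => F s) -> U s t -> partials (fun s _ => F s) s t (Derive F s) 0.
Proof.
intros HF Hst; apply (partials_eq _ _ _ _ _ _ _ (partials_smooth _ _ _ _ HF Hst)); trivial.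
exact (Derive_const (F s) t).
Qed.

Lemma smooth_Derive U (F : R -> R) :
  smooth_on U (fun s _ => F s) -> smooth_on U (fun s _ => Derive F s).
Proof. exact (smooth_ds U (fun s _ => F s)). Qed.

(** The left side is a monomial, so that the identity can serve as a rewriting rule in [ring [HC]]
    and [field [HC]]. *)
Lemma cos2_sin2 x : cos x * cos x = 1 - sin x * sin x.
Proof. generalize (sin2_cos2 x); unfold Rsqr; lra. Qed.

(** The coframe solved for from [xi1 = e ds] and [xi2 = e dt]: it is the pair [e ds], [e dt] with
    the rotation by [psi] undone. *)
Definition isothermal (U : R -> R -> Prop) (w1 w2 : Defs.form1) (e : R -> R)
    (psi : R -> R -> R) : Prop :=
  eq_on U w1 (fun s t => (e s * cos (psi s t), - (e s * sin (psi s t)))) /\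
  eq_on U w2 (fun s t => (e s * sin (psi s t), e s * cos (psi s t))).

(** The inverse of a rotation is its transpose: [w1 = cos psi xi1 - sin psi xi2] and
    [w2 = sin psi xi1 + cos psi xi2]. *)
Lemma xi_isothermal U w1 w2 e psi :
  eq_on U (xi1 w1 w2 psi) (fun s _ => (e s, 0)) ->
  eq_on U (xi2 w1 w2 psi) (fun s _ => (0, e s)) -> isothermal U w1 w2 e psi.
Proof.
intros H1 H2.
enough (H : forall s t, U s t ->
  w1 s t = (e s * cos (psi s t), - (e s * sin (psi s t))) /\
  w2 s t = (e s * sin (psi s t), e s * cos (psi s t))) by (split; intros s t Hst; apply H, Hst).
intros s t Hst; injection (H1 s t Hst) as E1 E2; injection (H2 s t Hst) as E3 E4.
unfold fscal in *; simpl in *.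
destruct (w1 s t) as [p1 q1], (w2 s t) as [p2 q2]; simpl in *.
set (C := cos (psi s t)) in *; set (S := sin (psi s t)) in *.
assert (HC : C * C = 1 - S * S) by apply cos2_sin2.
split; f_equal.
- transitivity (C * (C * p1 + S * p2) - S * (- S * p1 + C * p2)); [ring [HC] | rewrite E1, E3; ring].
- transitivity (C * (C * q1 + S * q2) - S * (- S * q1 + C * q2)); [ring [HC] | rewrite E2, E4; ring].
- transitivity (S * (C * p1 + S * p2) + C * (- S * p1 + C * p2)); [ring [HC] | rewrite E1, E3; ring].
- transitivity (S * (C * q1 + S * q2) + C * (- S * q1 + C * q2)); [ring [HC] | rewrite E2, E4; ring].
Qed.

(** At a point, the structure equations are two linear equations for the two coefficients of [th],
    with determinant [e^2]. Their only solution is [- dpsi + (e'/e) dt]. *)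
Lemma isothermal_connection U w1 w2 th e psi s t :
  open_2d U -> smooth_on U (fun s _ => e s) -> smooth_on U psi -> isothermal U w1 w2 e psi ->
  U s t -> 0 < e s ->
  ext_d1 w1 s t = wedge th w2 s t -> ext_d1 w2 s t = wedge w1 th s t ->
  fst (th s t) = - ds_ psi s t /\ snd (th s t) = Derive e s / e s - dt_ psi s t.
Proof.
intros HU He Hpsi [I1 I2] Hst He0; unfold ext_d1, wedge; rewrite (I1 s t Hst), (I2 s t Hst); simpl.
assert (Dsin := partials_mult _ _ _ _ _ _ _ _ (partials_1d _ _ _ _ He Hst)
  (partials_comp sin _ _ _ _ _ _ (is_derive_sin _) (partials_smooth _ _ _ _ Hpsi Hst))).
assert (Dcos := partials_mult _ _ _ _ _ _ _ _ (partials_1d _ _ _ _ He Hst)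
  (partials_comp cos _ _ _ _ _ _ (is_derive_cos _) (partials_smooth _ _ _ _ Hpsi Hst))).
rewrite (eq_on_ds U (fun s t => snd (w1 s t)) (fun s t => - (e s * sin (psi s t))));
  [ | trivial | now intros x y Hxy; rewrite (I1 x y Hxy) | trivial].
rewrite (eq_on_dt U (fun s t => fst (w1 s t)) (fun s t => e s * cos (psi s t)));
  [ | trivial | now intros x y Hxy; rewrite (I1 x y Hxy) | trivial].
rewrite (eq_on_ds U (fun s t => snd (w2 s t)) (fun s t => e s * cos (psi s t)));
  [ | trivial | now intros x y Hxy; rewrite (I2 x y Hxy) | trivial].
rewrite (eq_on_dt U (fun s t => fst (w2 s t)) (fun s t => e s * sin (psi s t)));
  [ | trivial | now intros x y Hxy; rewrite (I2 x y Hxy) | trivial].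
destruct (partials_unique _ _ _ _ _ (partials_opp _ _ _ _ _ Dsin)) as [-> _].
destruct (partials_unique _ _ _ _ _ Dsin) as [_ ->].
destruct (partials_unique _ _ _ _ _ Dcos) as [-> ->].
generalize (cos2_sin2 (psi s t)).
destruct (th s t) as [x y]; simpl.
generalize (cos (psi s t)) (sin (psi s t)) (ds_ psi s t) (dt_ psi s t) (Derive e s).
intros C S ps pt e' HC E1 E2.
(* The matrix of the system is [e] times a rotation; combining the equations with the transposed
   rotation isolates [e x] and then [e y]. *)
split; apply (Rmult_eq_reg_l (e s)); try lra.
- transitivity (C * (x * (e s * C) - y * (e s * S)) + S * (e s * C * y - - (e s * S) * x));
    [ring [HC] | rewrite <- E1, <- E2; ring [HC]].
- transitivity (- S * (x * (e s * C) - y * (e s * S)) + C * (e s * C * y - - (e s * S) * x));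
    [ring [HC] | rewrite <- E1, <- E2; field_simplify; [ring [HC] | lra]].
Qed.

(** * Principal curvatures, Codazzi equations and the equations for the angle [psi] *)

(** The factor [a] is recovered as [<z, w> / <w, w>]. This gives smoothness of the principal
    curvatures, which the frame does not assume. *)
Lemma smooth_eigenvalue U (w z : Defs.form1) a :
  open_2d U ->
  smooth_on U (fun s t => fst (w s t)) -> smooth_on U (fun s t => snd (w s t)) ->
  smooth_on U (fun s t => fst (z s t)) -> smooth_on U (fun s t => snd (z s t)) ->
  (forall s t, U s t -> fst (w s t) * fst (w s t) + snd (w s t) * snd (w s t) <> 0) ->
  eq_on U z (a *: w)%form -> smooth_on U a.
Proof.
intros HU Hw1 Hw2 Hz1 Hz2 H0 Hz.
apply (eq_on_smooth U (fun s t => (fst (z s t) * fst (w s t) + snd (z s t) * snd (w s t)) *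
  / (fst (w s t) * fst (w s t) + snd (w s t) * snd (w s t)))); trivial.
- intros s t Hst; rewrite (Hz s t Hst); unfold fscal; simpl; field; now apply H0.
- apply smooth_expr_smooth; trivial.
  apply expr_mult; [ | apply expr_inv; trivial]; apply expr_plus; apply expr_mult;
    now apply expr_smooth.
Qed.

(** The Codazzi equations give all partial derivatives of [a] and [c]. Their sum gives [dH]; their
    difference gives [dJ], and as [J] depends on [s] only this is two linear relations between [h]
    and [k]. Matching them with the coefficients of the connection form gives [psi_s] and
    [psi_t]. *)
Lemma codazzi_isothermal U w1 w2 a c h k u v psi (A H J e : R -> R) s t :
  open_2d U -> isothermal U w1 w2 e psi -> codazzi_functions U w1 w2 a c h k u v ->
  smooth_on U a -> smooth_on U c ->
  smooth_on U (fun s _ => H s) -> smooth_on U (fun s _ => J s) ->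
  (forall s t, U s t -> mean_curvature a c s t = H s) ->
  (forall s t, U s t -> skew_curvature a c s t = J s) ->
  U s t -> c s t < a s t -> 0 < e s ->
  u s t = A s * cos (psi s t) -> v s t = A s * sin (psi s t) ->
  fst ((h *: w1 + k *: w2)%form s t) = - ds_ psi s t ->
  snd ((h *: w1 + k *: w2)%form s t) = Derive e s / e s - dt_ psi s t ->
  ext_d0 (mean_curvature a c) s t = (J s * (A s * e s), 0) /\
  Derive H s = J s * (A s * e s) /\
  ds_ psi s t = - (A s * e s * sin (2 * psi s t)) / 2 /\
  dt_ psi s t = (Derive J s / J s + 2 * (Derive e s / e s) - A s * e s * cos (2 * psi s t)) / 2.
Proof.
intros HU [I1 I2] [C1 C2] Ha Hc HH HJ EH EJ Hst Hac He0 Eu Ev F1 F2.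
injection (C1 s t Hst) as Ca1 Ca2; injection (C2 s t Hst) as Cc1 Cc2.
unfold ext_d0.
assert (D := partials_mult _ _ _ _ _ _ _ _ (partials_const (/ 2) s t)
  (partials_plus _ _ _ _ _ _ _ _ (partials_smooth _ _ _ _ Ha Hst) (partials_smooth _ _ _ _ Hc Hst))).
destruct (partials_unique _ _ _ _ _ D) as [D1 D2].
change (ds_ (mean_curvature a c) s t = 0 * (a s t + c s t) + / 2 * (ds_ a s t + ds_ c s t)) in D1.
change (dt_ (mean_curvature a c) s t = 0 * (a s t + c s t) + / 2 * (dt_ a s t + dt_ c s t)) in D2.
destruct (partials_unique _ _ _ _ _
  (eq_on_partials U _ (fun s _ => H s) _ _ _ _ HU EH Hst D)) as [D3 _].
destruct (partials_unique _ _ _ _ _ (partials_1d _ _ _ _ HH Hst)) as [D4 _]; rewrite D4 in D3.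
assert (D' := partials_mult _ _ _ _ _ _ _ _ (partials_const (/ 2) s t)
  (partials_plus _ _ _ _ _ _ _ _ (partials_smooth _ _ _ _ Ha Hst)
    (partials_opp _ _ _ _ _ (partials_smooth _ _ _ _ Hc Hst)))).
destruct (partials_unique _ _ _ _ _
  (eq_on_partials U _ (fun s _ => J s) _ _ _ _ HU EJ Hst D')) as [D5 D6].
destruct (partials_unique _ _ _ _ _ (partials_1d _ _ _ _ HJ Hst)) as [D7 D8].
rewrite D7 in D5; rewrite D8 in D6.
rewrite D1, D2, D3.
assert (EJ0 : a s t - c s t = 2 * J s)
  by (rewrite <- (EJ s t Hst); unfold skew_curvature; field).
assert (HJ0 : J s <> 0) by lra.
unfold fadd, fscal in *; rewrite (I1 s t Hst), (I2 s t Hst) in *; simpl in *.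
rewrite EJ0 in *; rewrite Eu, Ev in *.
rewrite sin_2a, cos_2a.
assert (HC := cos2_sin2 (psi s t)).
set (C := cos (psi s t)) in *; set (S := sin (psi s t)) in *.
set (h0 := h s t) in *; set (k0 := k s t) in *.
assert (Das : ds_ a s t = 2 * J s * (h0 * (e s * S) + (A s * C - k0) * (e s * C))).
{ rewrite <- Ca1; field; trivial. }
assert (Dat : dt_ a s t = 2 * J s * (h0 * (e s * C) + (A s * C - k0) * - (e s * S))).
{ rewrite <- Ca2; field; trivial. }
assert (Dcs : ds_ c s t = 2 * J s * (k0 * (e s * C) + (A s * S - h0) * (e s * S))).
{ rewrite <- Cc1; field; trivial. }
assert (Dct : dt_ c s t = 2 * J s * (k0 * - (e s * S) + (A s * S - h0) * (e s * C))).
{ rewrite <- Cc2; field; trivial. }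
rewrite Das, Dcs in *; rewrite Dat, Dct in *.
assert (E0 : 0 * (a s t + c s t) + / 2 * (2 * J s * (h0 * (e s * S) + (A s * C - k0) * (e s * C)) +
   2 * J s * (k0 * (e s * C) + (A s * S - h0) * (e s * S))) = J s * (A s * e s)).
{ transitivity (J s * (A s * e s) * (C * C + S * S)); [field | rewrite HC; ring]. }
split; [f_equal; [exact E0 | field] | split; [exact E0 | ]].
(* [D6] reads [0 = J_t]; up to the factor [2 J], this determines the [ds] coefficient of the
   connection form. *)
assert (K1 : J s * (2 * (h0 * (e s * C) + k0 * (e s * S)) - 2 * (e s * A s * S * C)) = 0)
  by (rewrite D6; field).
(* The value of [J_s] determines the [dt] coefficient in the same way. *)
assert (K2 : Derive J s = J s * (2 * (h0 * (e s * S) - k0 * (e s * C)) + e s * A s * (C * C - S * S)))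
  by (rewrite D5; field).
apply Rmult_integral in K1; destruct K1 as [K1|K1]; [easy | ].
rewrite K2; split.
- lra.
- replace (J s * (2 * (h0 * (e s * S) - k0 * (e s * C)) + e s * A s * (C * C - S * S)) / J s)
    with (2 * (h0 * (e s * S) - k0 * (e s * C)) + e s * A s * (C * C - S * S)) by now field.
  lra.
Qed.

Lemma partials_double_angle U (F F' : R -> R) psi s t :
  (forall x, is_derive F x (F' x)) -> smooth_on U psi -> U s t ->
  partials (fun s t => F (2 * psi s t)) s t
    (2 * ds_ psi s t * F' (2 * psi s t)) (2 * dt_ psi s t * F' (2 * psi s t)).
Proof.
intros HF Hpsi Hst; eapply partials_eq.
- apply (partials_comp F); [apply HF | ].
  exact (partials_mult _ _ _ _ _ _ _ _ (partials_const 2 s t) (partials_smooth _ _ _ _ Hpsi Hst)).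
- cbv beta; ring.
- cbv beta; ring.
Qed.

(** Once [psi_s] and [psi_t] are inserted, the terms quadratic in [q] cancel. The two equations say
    that [q' - q P] is annihilated by both [sin (2 psi)] and [cos (2 psi)], which have no common
    zero. *)
Lemma closed_alpha_forms U (w z : Defs.form1) (q : R -> R) psi P s t :
  open_2d U -> smooth_on U (fun s _ => q s) -> smooth_on U psi ->
  eq_on U w (fun s t => (q s * cos (2 * psi s t), - (q s * sin (2 * psi s t)))) ->
  eq_on U z (fun s t => (q s * sin (2 * psi s t), q s * cos (2 * psi s t))) ->
  U s t -> ext_d1 w s t = 0 -> ext_d1 z s t = wedge w z s t ->
  ds_ psi s t = - (q s * sin (2 * psi s t)) / 2 ->
  dt_ psi s t = (P - q s * cos (2 * psi s t)) / 2 ->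
  Derive q s = q s * P.
Proof.
intros HU Hq Hpsi Hw Hz Hst; unfold ext_d1, wedge; rewrite (Hw s t Hst), (Hz s t Hst); simpl.
assert (Dsin := partials_mult _ _ _ _ _ _ _ _ (partials_1d _ _ _ _ Hq Hst)
  (partials_double_angle U sin cos psi s t is_derive_sin Hpsi Hst)).
assert (Dcos := partials_mult _ _ _ _ _ _ _ _ (partials_1d _ _ _ _ Hq Hst)
  (partials_double_angle U cos (fun x => - sin x) psi s t is_derive_cos Hpsi Hst)).
rewrite (eq_on_ds U (fun s t => snd (w s t)) (fun s t => - (q s * sin (2 * psi s t))));
  [ | trivial | now intros x y Hxy; rewrite (Hw x y Hxy) | trivial].
rewrite (eq_on_dt U (fun s t => fst (w s t)) (fun s t => q s * cos (2 * psi s t)));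
  [ | trivial | now intros x y Hxy; rewrite (Hw x y Hxy) | trivial].
rewrite (eq_on_ds U (fun s t => snd (z s t)) (fun s t => q s * cos (2 * psi s t)));
  [ | trivial | now intros x y Hxy; rewrite (Hz x y Hxy) | trivial].
rewrite (eq_on_dt U (fun s t => fst (z s t)) (fun s t => q s * sin (2 * psi s t)));
  [ | trivial | now intros x y Hxy; rewrite (Hz x y Hxy) | trivial].
destruct (partials_unique _ _ _ _ _ (partials_opp _ _ _ _ _ Dsin)) as [-> _].
destruct (partials_unique _ _ _ _ _ Dsin) as [_ ->].
destruct (partials_unique _ _ _ _ _ Dcos) as [-> ->].
intros E1 E2 E3 E4; rewrite E3, E4 in E1, E2; revert E1 E2.
generalize (cos2_sin2 (2 * psi s t)).
generalize (cos (2 * psi s t)) (sin (2 * psi s t)) (Derive q s).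
intros C S q' HC E1 E2.
assert (K1 : S * (q' - q s * P) = 0) by lra.
assert (K2 : C * (q' - q s * P) = 0) by nra.
assert (K : (C * C + S * S) * (q' - q s * P) = 0)
  by (rewrite Rmult_plus_distr_r, !Rmult_assoc, K1, K2; ring).
rewrite HC in K; lra.
Qed.

(** Equate the mixed derivatives of [psi]: after [q' = q P] the terms in [q P cos (2 psi)] cancel,
    and the squares of sine and cosine add up to [q^2]. *)
Lemma psi_integrability U (q P : R -> R) psi s t :
  open_2d U -> smooth_on U (fun s _ => q s) -> smooth_on U (fun s _ => P s) ->
  smooth_on U psi ->
  eq_on U (ds_ psi) (fun s t => - / 2 * (q s * sin (2 * psi s t))) ->
  eq_on U (dt_ psi) (fun s t => / 2 * (P s + - (q s * cos (2 * psi s t)))) ->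
  U s t -> Derive q s = q s * P s -> Derive P s = q s ^ 2.
Proof.
intros HU Hq HP Hpsi Hs Ht Hst Eq.
assert (Dsin := partials_mult _ _ _ _ _ _ _ _ (partials_1d _ _ _ _ Hq Hst)
  (partials_double_angle U sin cos psi s t is_derive_sin Hpsi Hst)).
assert (Dcos := partials_mult _ _ _ _ _ _ _ _ (partials_1d _ _ _ _ Hq Hst)
  (partials_double_angle U cos (fun x => - sin x) psi s t is_derive_cos Hpsi Hst)).
assert (E := smooth_schwarz U psi s t HU Hpsi Hst).
rewrite (eq_on_ds U _ _ s t HU Ht Hst), (eq_on_dt U _ _ s t HU Hs Hst) in E.
destruct (partials_unique _ _ _ _ _ (partials_mult _ _ _ _ _ _ _ _
  (partials_const (- / 2) s t) Dsin)) as [_ E1].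
destruct (partials_unique _ _ _ _ _ (partials_mult _ _ _ _ _ _ _ _
  (partials_const (/ 2) s t) (partials_plus _ _ _ _ _ _ _ _ (partials_1d _ _ _ _ HP Hst)
    (partials_opp _ _ _ _ _ Dcos)))) as [E2 _].
rewrite E1, E2, (Hs s t Hst), (Ht s t Hst), Eq in E; revert E.
generalize (cos2_sin2 (2 * psi s t)).
generalize (cos (2 * psi s t)) (sin (2 * psi s t)); intros C S HC E.
nra.
Qed.

(** * The mean curvature equation *)

Lemma smooth_quotient U f g :
  open_2d U -> smooth_on U f -> smooth_on U g -> (forall s t, U s t -> g s t <> 0) ->
  smooth_on U (fun s t => f s t / g s t).
Proof.
intros HU Hf Hg H0; apply smooth_expr_smooth; trivial.
apply expr_mult; [ | apply expr_inv; trivial]; now apply expr_smooth.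
Qed.

Definition log_derivative (F : R -> R) (s : R) : R := Derive F s / F s.

Lemma smooth_log_derivative U F :
  open_2d U -> smooth_on U (fun s _ => F s) -> (forall s t, U s t -> F s <> 0) ->
  smooth_on U (fun s _ => log_derivative F s).
Proof.
intros HU HF H0; apply smooth_quotient; trivial; now apply smooth_Derive.
Qed.

(** The hypothesis on [q'] says that [e^2 J / q] has logarithmic derivative zero, hence is constant
    on the interval; [tau] is its value at an arbitrary point. *)
Lemma isothermal_factor_constant l r (J q e : R -> R) :
  (forall s, in_interval l r s ->
     0 < J s /\ 0 < q s /\ ex_derive J s /\ ex_derive q s /\ ex_derive e s /\ 0 < e s /\
     Derive q s = q s * (log_derivative J s + 2 * log_derivative e s)) ->
  Rbar_lt l r ->
  exists tau, forall s, in_interval l r s -> e s ^ 2 = tau * (q s / J s).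
Proof.
intros Hq Hlr; destruct (in_interval_inhabited l r Hlr) as [x Hx].
set (K := fun s => e s ^ 2 * J s / q s).
assert (HK : forall s, in_interval l r s -> is_derive K s zero).
{ intros s Hs; destruct (Hq s Hs) as (HJ & Hq0 & DJ & Dq & De & He & Eq).
  unfold K; auto_derive; [repeat split; trivial; lra | ].
  unfold log_derivative in Eq; change (Derive (fun x => q x) s) with (Derive q s).
  change (Derive (fun x => J x) s) with (Derive J s).
  change (Derive (fun x => e x) s) with (Derive e s).
  rewrite Eq; change zero with 0; field; lra. }
assert (Hc : forall y z, in_interval l r y -> in_interval l r z -> y < z -> K y = K z).
{ intros y z Hy Hz Hyz; apply eq_is_derive; trivial.
  intros w Hw; apply HK; now apply (in_interval_convex l r y z). }
exists (K x); intros s Hs; replace (K x) with (K s).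
- destruct (Hq s Hs) as (HJ & Hq0 & _); unfold K; field; lra.
- destruct (Rtotal_order s x) as [H|[H|H]]; [now apply Hc | now subst | symmetry; now apply Hc].
Qed.

(** With [e^2 = tau q / J] and [H' = J q], the Gauss term [(H^2 - J^2) e^2] splits into
    [tau q^2 H^2 / H'] and [- tau H']; the latter moves to the left side. *)
Lemma mean_curvature_ode U (H J q e : R -> R) tau s t :
  open_2d U -> smooth_on U (fun s _ => H s) -> smooth_on U (fun s _ => J s) ->
  smooth_on U (fun s _ => e s) ->
  (forall s t, U s t -> 0 < J s /\ 0 < q s /\ 0 < e s /\
     Derive H s = J s * q s /\
     Derive q s = q s * (log_derivative J s + 2 * log_derivative e s) /\
     Derive (fun s => log_derivative J s + 2 * log_derivative e s) s = q s ^ 2 /\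
     Derive (log_derivative e) s = - ((H s ^ 2 - J s ^ 2) * e s ^ 2)) ->
  U s t -> e s ^ 2 = tau * (q s / J s) ->
  ex_derive_n H 3 s /\
  Derive (fun x => Derive_n H 2 x / Derive H x) s + 2 * tau * Derive H s
    = 2 * q s ^ 2 * (1 + tau * (H s ^ 2 / Derive H s)).
Proof.
intros HU HH HJ He Hsys Hst Htau; split.
{ exact (ex_intro _ _ (proj1 (partials_smooth _ _ _ _
    (smooth_Derive _ _ (smooth_Derive _ _ HH)) Hst))). }
(* Smoothness of [q] comes from [q = H' / J]. *)
assert (Hq : smooth_on U (fun s _ => q s)).
{ apply (eq_on_smooth U (fun s _ => Derive H s / J s)); trivial.
  - intros x y Hxy; destruct (Hsys x y Hxy) as (HJ0 & _ & _ & -> & _); field; lra.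
  - apply smooth_quotient; trivial; [now apply smooth_Derive | ].
    intros x y Hxy; destruct (Hsys x y Hxy); lra. }
set (P := fun s => log_derivative J s + 2 * log_derivative e s) in *.
assert (Hle : smooth_on U (fun s _ => log_derivative e s)).
{ apply smooth_log_derivative; trivial; intros x y Hxy.
  destruct (Hsys x y Hxy) as (_ & _ & H0 & _); lra. }
assert (HP : smooth_on U (fun s _ => P s)).
{ apply smooth_expr_smooth; trivial; unfold P.
  apply expr_plus; [ | apply expr_mult; [apply expr_const | now apply expr_smooth]].
  apply expr_smooth, smooth_log_derivative; trivial.
  intros x y Hxy; destruct (Hsys x y Hxy); lra. }
assert (H2 : eq_on U (fun x _ => Derive_n H 2 x / Derive H x)
   (fun x _ => 2 * (P x + - log_derivative e x))).
{ intros x y Hxy; destruct (Hsys x y Hxy) as (HJ0 & Hq0 & He0 & EH & Eq & _).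
  assert (E : eq_on U (fun s _ => Derive H s) (fun s _ => J s * q s))
    by (intros w z Hwz; apply (Hsys w z Hwz)).
  apply (eq_on_ds U _ _ x y HU) in E; trivial.
  change (Derive_n H 2 x = ds_ (fun s _ => J s * q s) x y) in E.
  destruct (partials_unique _ _ _ _ _ (partials_mult _ _ _ _ _ _ _ _
    (partials_1d _ _ _ _ HJ Hxy) (partials_1d _ _ _ _ Hq Hxy))) as [E' _].
  rewrite E, E', EH, Eq; unfold P, log_derivative; field; lra. }
destruct (Hsys s t Hst) as (HJ0 & Hq0 & He0 & EH & Eq & EP & Ee).
destruct (partials_unique _ _ _ _ _ (partials_mult _ _ _ _ _ _ _ _ (partials_const 2 s t)
  (partials_plus _ _ _ _ _ _ _ _ (partials_1d _ _ _ _ HP Hst)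
    (partials_opp _ _ _ _ _ (partials_1d _ _ _ _ Hle Hst))))) as [D _].
apply (eq_on_ds U _ _ s t HU) in H2; trivial.
rewrite D in H2; unfold ds_ in H2.
rewrite H2, EP, Ee, EH, Htau; field; lra.
Qed.

Theorem mainTheorem7
  (s0 s1 t0 t1 : Rbar)
  (X e1 e2 e3 : R -> R -> vec3)
  (a c h k u v psi : R -> R -> R)
  (A H J e : R -> R) :
  let U := rectangle s0 s1 t0 t1 in
  let w1 := omega1 X e1 in
  let w2 := omega2 X e2 in
  let a1 := alpha1 w1 w2 u v in
  let a2 := alpha2 w1 w2 u v in
  Rbar_lt s0 s1 -> Rbar_lt t0 t1 ->
  surface_patch U X ->
  principal_frame U X e1 e2 e3 a c ->
  connection_form U w1 w2 (h *: w1 + k *: w2)%form ->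
  codazzi_functions U w1 w2 a c h k u v ->
  (forall s t, U s t -> ext_d0 (mean_curvature a c) s t <> (0, 0)) ->
  eq_on U (ext_d1 a1) (fun _ _ => 0) ->
  eq_on U (ext_d1 a2) (wedge a1 a2) ->
  (forall s t, U s t -> sqrt (u s t ^ 2 + v s t ^ 2) = A s) ->
  (forall s t, U s t -> mean_curvature a c s t = H s) ->
  (forall s t, U s t -> skew_curvature a c s t = J s) ->
  smooth_on U psi ->
  (forall s t, U s t -> u s t = A s * cos (psi s t)) ->
  (forall s t, U s t -> v s t = A s * sin (psi s t)) ->
  (forall s, in_interval s0 s1 s -> 0 < e s) ->
  eq_on U (xi1 w1 w2 psi) (fun s _ => (e s, 0)) ->
  eq_on U (xi2 w1 w2 psi) (fun s _ => (0, e s)) ->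
  let H' := Derive H in
  let H'' := Derive_n H 2 in
  let Q := fun s => H' s / J s in
  let E := fun s => e s ^ 2 in
  (forall s, in_interval s0 s1 s -> Q s = A s * e s /\ 0 < Q s) /\
  exists tau : R,
    (forall s, in_interval s0 s1 s ->
       E s = tau * (Q s / J s) /\ E s = tau * (Q s ^ 2 / H' s)) /\
    (forall s, in_interval s0 s1 s ->
       ex_derive_n H 3 s /\
       Derive (fun x => H'' x / H' x) s + 2 * tau * H' s
         = 2 * Q s ^ 2 * (1 + tau * (H s ^ 2 / H' s))) /\
    (forall s t, U s t ->
       let L := E s * (H s + J s * cos (2 * psi s t)) in
       let M := - (E s * J s * sin (2 * psi s t)) in
       let N := E s * (H s - J s * cos (2 * psi s t)) in
       (forall x y,
          first_form X s t x y = E s * (x ^ 2 + y ^ 2) /\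
          second_form X e3 s t x y = L * x ^ 2 + 2 * M * x * y + N * y ^ 2) /\
       L = E s * H s + tau * Q s * cos (2 * psi s t) /\
       M = - (tau * Q s * sin (2 * psi s t))).
Proof.
intros U w1 w2 a1 a2 Hs01 Ht01 HX HF [HC1 HC2] Hcod Hcrit Ha1 Ha2 HA EH EJ Hpsi Eu Ev He0 Hx1 Hx2
  H' H'' Q E.
assert (HU : open_2d U) by apply rectangle_open.
(* A fixed [t] turns each [s] into a point of the rectangle, where statements about functions of [s]
   alone are proved. *)
destruct (in_interval_inhabited _ _ Ht01) as [t Ht].
assert (HUt : forall s, in_interval s0 s1 s -> U s t) by (now intros s Hs).
assert (Hiso := xi_isothermal U w1 w2 e psi Hx1 Hx2).
assert (HF' := HF); destruct HF' as [S1 S2 S3 _ _ _ _ _ _ _ W13 W23 Hac].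
destruct (HX) as [SX _].
assert (Hdf : forall V W, vsmooth_on U V -> vsmooth_on U W ->
  smooth_on U (fun s t => fst (dform V W s t)) /\ smooth_on U (fun s t => snd (dform V W s t))).
{ intros V W HV HW; split.
  - exact (smooth_dot U _ _ HU (vsmooth_vds _ _ HV) HW).
  - exact (smooth_dot U _ _ HU (vsmooth_vdt _ _ HV) HW). }
destruct (Hdf X e1 SX S1) as [Hw1s Hw1t], (Hdf X e2 SX S2) as [Hw2s Hw2t].
(* [e] is the [ds] coefficient of [xi1], hence built from smooth functions. *)
assert (He : smooth_on U (fun s _ => e s)).
{ apply (eq_on_smooth U (fun s t => cos (psi s t) * fst (w1 s t) + sin (psi s t) * fst (w2 s t)));
    trivial.
  - intros s y Hsy; now injection (Hx1 s y Hsy).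
  - apply smooth_expr_smooth; trivial; apply expr_plus; apply expr_mult;
      try (now apply expr_smooth); [apply expr_cos | apply expr_sin]; now apply expr_smooth. }
(* The squared coefficient norm of either form is [e^2], the denominator in [smooth_eigenvalue]. *)
assert (Hnorm : forall w, w = w1 \/ w = w2 -> forall s t, U s t ->
  fst (w s t) * fst (w s t) + snd (w s t) * snd (w s t) <> 0).
{ destruct Hiso as [I1 I2]; intros w Hw s y Hsy.
  assert (Hes := He0 s (proj1 Hsy)); assert (HC := cos2_sin2 (psi s y)).
  assert (0 < e s * e s) by nra.
  destruct Hw as [-> | ->]; [rewrite (I1 s y Hsy) | rewrite (I2 s y Hsy)]; simpl;
    apply Rgt_not_eq.
  - replace (_ + _) with (e s * e s) by ring [HC]; lra.
  - replace (_ + _) with (e s * e s) by ring [HC]; lra. }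
assert (Sa : smooth_on U a).
{ destruct (Hdf e1 e3 S1 S3); apply (smooth_eigenvalue U w1 (dform e1 e3)); auto. }
assert (Sc : smooth_on U c).
{ destruct (Hdf e2 e3 S2 S3); apply (smooth_eigenvalue U w2 (dform e2 e3)); auto. }
assert (SH : smooth_on U (fun s _ => H s)).
{ apply (eq_on_smooth U (mean_curvature a c)); trivial; apply smooth_expr_smooth; trivial.
  apply expr_mult; [apply expr_const | apply expr_plus; now apply expr_smooth]. }
assert (SJ : smooth_on U (fun s _ => J s)).
{ apply (eq_on_smooth U (skew_curvature a c)); trivial; apply smooth_expr_smooth; trivial.
  apply expr_mult; [apply expr_const | apply expr_plus; [ | apply expr_opp]; now apply expr_smooth]. }
assert (HJ0 : forall s y, U s y -> 0 < J s).
{ intros s y Hsy; rewrite <- (EJ s y Hsy); unfold skew_curvature.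
  specialize (Hac s y Hsy); lra. }
(* Kept general in [th]: it is applied to [h *: w1 + k *: w2] for the Codazzi equations and to
   [dform e1 e2] for the Gauss equation. *)
assert (Hconn : forall th, eq_on U (ext_d1 w1) (wedge th w2) -> eq_on U (ext_d1 w2) (wedge w1 th) ->
  forall s y, U s y -> fst (th s y) = - ds_ psi s y /\
    snd (th s y) = log_derivative e s - dt_ psi s y).
{ intros th E1 E2 s y Hsy; apply (isothermal_connection U w1 w2); auto.
  apply He0, Hsy. }
assert (Hpsi' : forall s y, U s y -> _) by (intros s y Hsy;
  exact (codazzi_isothermal U w1 w2 a c h k u v psi A H J e s y HU Hiso Hcod Sa Sc SH SJ EH EJ Hsy
    (Hac s y Hsy) (He0 s (proj1 Hsy)) (Eu s y Hsy) (Ev s y Hsy)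
    (proj1 (Hconn _ HC1 HC2 s y Hsy)) (proj2 (Hconn _ HC1 HC2 s y Hsy)))).
assert (HQ : forall s, in_interval s0 s1 s -> Q s = A s * e s /\ 0 < Q s).
{ intros s Hs; assert (Hst := HUt s Hs); destruct (Hpsi' s t Hst) as (EdH & EH' & _).
  assert (EQ : Q s = A s * e s).
  { unfold Q, H'; rewrite EH'; field; specialize (HJ0 s t Hst); lra. }
  split; trivial; rewrite EQ.
  (* As a square root [A] is non-negative; if it vanished, [dH = J A e ds] would vanish too, against
     the absence of critical points. *)
  assert (HA0 : 0 <= A s) by (rewrite <- (HA s t Hst); apply sqrt_pos).
  apply Rmult_lt_0_compat; [ | now apply He0].
  destruct HA0 as [ | HA0]; trivial; exfalso.
  apply (Hcrit s t Hst); rewrite EdH, <- HA0; f_equal; ring. }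
assert (SQ : smooth_on U (fun s _ => Q s)).
{ apply smooth_quotient; trivial; [now apply smooth_Derive | ].
  intros x y Hxy; specialize (HJ0 x y Hxy); lra. }
set (P := fun s => log_derivative J s + 2 * log_derivative e s).
assert (Sle : smooth_on U (fun s _ => log_derivative e s)).
{ apply smooth_log_derivative; trivial; intros x y Hxy; apply Rgt_not_eq, He0, Hxy. }
assert (SP : smooth_on U (fun s _ => P s)).
{ apply smooth_expr_smooth; trivial; unfold P.
  apply expr_plus; [ | apply expr_mult; [apply expr_const | now apply expr_smooth]].
  apply expr_smooth, smooth_log_derivative; trivial.
  intros x y Hxy; now apply Rgt_not_eq, (HJ0 x y). }
assert (Hds : forall s y, U s y -> ds_ psi s y = - (Q s * sin (2 * psi s y)) / 2).
{ intros s y Hsy; rewrite (proj1 (HQ s (proj1 Hsy))); apply Hpsi', Hsy. }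
assert (Hdt : forall s y, U s y -> dt_ psi s y = (P s - Q s * cos (2 * psi s y)) / 2).
{ intros s y Hsy; rewrite (proj1 (HQ s (proj1 Hsy))); apply Hpsi', Hsy. }
(* The double-angle formulas bring [a1] and [a2] to the shape of [closed_alpha_forms] with amplitude
   [Q = A e]. *)
assert (DQ : forall s y, U s y -> Derive Q s = Q s * P s).
{ intros s y Hsy; apply (closed_alpha_forms U a1 a2 Q psi (P s) s y); auto;
    intros x z Hxz; unfold a1, a2, alpha1, alpha2, fadd, fsub, fscal;
    rewrite (proj1 Hiso x z Hxz), (proj2 Hiso x z Hxz), (Eu x z Hxz), (Ev x z Hxz),
      (proj1 (HQ x (proj1 Hxz))), sin_2a, cos_2a; simpl; f_equal; ring. }
assert (DP : forall s y, U s y -> Derive P s = Q s ^ 2).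
{ intros s y Hsy; apply (psi_integrability U Q P psi s y); auto.
  - intros x z Hxz; rewrite (Hds x z Hxz); field.
  - intros x z Hxz; rewrite (Hdt x z Hxz); field.
  - now apply (DQ s y). }
(* The Gauss equation for the connection form [(e'/e) dt - dpsi]: the part from [dpsi] drops out by
   symmetry of second derivatives, [w1] wedge [w2] is [e^2 ds dt], and [a c = H^2 - J^2]. *)
assert (Dle : forall s y, U s y ->
  Derive (log_derivative e) s = - ((H s ^ 2 - J s ^ 2) * e s ^ 2)).
{ intros s y Hsy.
  assert (G := frame_gauss_equation U X e1 e2 e3 a c s y HU HX HF Hsy).
  assert (Hth := Hconn (dform e1 e2)
    (fun s t Hst => proj1 (frame_structure_equations _ _ _ _ _ _ _ s t HU HX HF Hst))
    (fun s t Hst => proj2 (frame_structure_equations _ _ _ _ _ _ _ s t HU HX HF Hst))).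
  fold w1 w2 in G; unfold ext_d1, wedge in G.
  rewrite (eq_on_ds U (fun s t => snd (dform e1 e2 s t))
    (fun s t => log_derivative e s + - dt_ psi s t)) in G;
    [ | trivial | intros x z Hxz; now apply Hth | trivial].
  rewrite (eq_on_dt U (fun s t => fst (dform e1 e2 s t)) (fun s t => - ds_ psi s t)) in G;
    [ | trivial | intros x z Hxz; now apply Hth | trivial].
  destruct (partials_unique _ _ _ _ _ (partials_plus _ _ _ _ _ _ _ _ (partials_1d _ _ _ _ Sle Hsy)
    (partials_opp _ _ _ _ _ (partials_smooth _ _ _ _ (smooth_dt _ _ Hpsi) Hsy)))) as [G1 _].
  destruct (partials_unique _ _ _ _ _
    (partials_opp _ _ _ _ _ (partials_smooth _ _ _ _ (smooth_ds _ _ Hpsi) Hsy))) as [_ G2].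
  rewrite G1, G2, (smooth_schwarz U), (proj1 Hiso s y Hsy), (proj2 Hiso s y Hsy) in G; trivial.
  simpl in G; rewrite <- (EH s y Hsy), <- (EJ s y Hsy).
  unfold mean_curvature, skew_curvature.
  assert (HC := cos2_sin2 (psi s y)).
  transitivity (- (a s y * c s y * (e s * e s))); [ | field].
  transitivity (- (a s y * c s y * (e s * cos (psi s y) * (e s * cos (psi s y)) -
      - (e s * sin (psi s y)) * (e s * sin (psi s y))))); [lra | ring [HC]]. }
split; trivial.
destruct (isothermal_factor_constant s0 s1 J Q e) as [tau Htau]; trivial.
{ intros s Hs; assert (Hst := HUt s Hs); split; [now apply (HJ0 s t) | split; [now apply HQ | ]].
  split; [exact (ex_intro _ _ (proj1 (partials_1d _ _ _ _ SJ Hst))) | ].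
  split; [exact (ex_intro _ _ (proj1 (partials_1d _ _ _ _ SQ Hst))) | ].
  split; [exact (ex_intro _ _ (proj1 (partials_1d _ _ _ _ He Hst))) | ].
  split; [now apply He0 | now apply (DQ s t)]. }
assert (EH' : forall s, in_interval s0 s1 s -> H' s = J s * Q s).
{ intros s Hs; unfold Q; field; apply Rgt_not_eq, (HJ0 s t), HUt, Hs. }
exists tau; split; [ | split].
- intros s Hs; split; [now apply Htau | ]; unfold E; rewrite Htau, EH' by trivial.
  specialize (HJ0 s t (HUt s Hs)); destruct (HQ s Hs); field; lra.
- intros s Hs; apply (mean_curvature_ode U H J Q e tau s t); auto.
  intros x y Hxy; repeat split; try (now apply HQ, Hxy); try (now apply He0, Hxy);
    [now apply (HJ0 x y) | now apply EH', Hxy | now apply (DQ x y) | now apply (DP x y)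
    | now apply (Dle x y)].
- intros s y Hsy L M N.
  (* The identity [tau Q = E J] gives the second expressions for [L] and [M]. *)
  assert (HT : tau * Q s = e s ^ 2 * J s).
  { rewrite (Htau s (proj1 Hsy)); specialize (HJ0 s y Hsy); field; lra. }
  split; [ | split].
  + intros x z.
    destruct (frame_fundamental_forms U X e1 e2 e3 a c s y x z HU HF Hsy) as [-> ->].
    fold w1 w2; unfold eval1; rewrite (proj1 Hiso s y Hsy), (proj2 Hiso s y Hsy).
    unfold L, M, N, E; rewrite <- (EH s y Hsy), <- (EJ s y Hsy), sin_2a, cos_2a; simpl fst; simpl snd.
    unfold mean_curvature, skew_curvature.
    assert (HC := cos2_sin2 (psi s y)).
    (* With [a = H + J] and [c = H - J], the sum [a w1^2 + c w2^2] expands into [L], [M], [N] by the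
       double-angle formulas. *)
    split; [ring [HC] | field [HC]].
  + unfold L, E; rewrite HT; ring.
  + unfold M, E; rewrite HT; ring.
Qed.
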